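(* The generating function for partitions with respect to their semiperimeter and their degree of symmetry is $$\sum_{\lambda\in\mathcal P} s^{\mathrm{ds}(\lambda)} z^{\mathrm{sp}(\lambda)} =1+\frac{z^2\left(\sqrt{1-4z^2}-(1-s)(1-2z)\right)}{(1-2z)\left(2(1-s)z^2+\sqrt{1-4z^2}\right)}.$$
   Context: $\mathcal P$ is the set of all integer partitions, i.e. sequences $\lambda=(\lambda_1,\dots,\lambda_k)$ with $k\ge0$ and $\lambda_1\ge\dots\ge\lambda_k\ge1$ (including the empty partition, for which $\lambda_1=\lambda_1'=0$). The conjugate $\lambda'$ of $\lambda$ is the partition with parts $\lambda'_i=|\{j:\lambda_j\ge i\}|$ for $1\le i\le\lambda_1$; in particular $\lambda_1'$ is the number of parts of $\lambda$. The degree of symmetry is $\mathrm{ds}(\lambda)=|\{i:\lambda_i=\lambda'_i\}|$, the number of parts of $\lambda$ that equal the corresponding part of its conjugate (only indices $i$ for which both $\lambda_i$ and $\lambda_i'$ are defined, i.e. are positive parts, count). The semiperimeter is $\mathrm{sp}(\lambda)=\lambda_1+\lambda_1'$. The identity is between formal power series in $z$ with coefficients polynomials in $s$, with $\sqrt{1-4z^2}$ having constant term $1$. *)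

(* Defs.v *)
From HB Require Import structures.
From mathcomp Require Import all_boot all_order all_algebra.
From mathcomp Require Import boolp classical_sets functions cardinality fsbigop.

Set Implicit Arguments.
Unset Strict Implicit.
Unset Printing Implicit Defensive.

Import GRing.Theory.
Local Open Scope ring_scope.

(** * Formal power series in one variable *)

(* A record rather than an alias of [nat -> R], so that the pointwise product
   on functions can never be picked up in place of the Cauchy product. *)
Record fps (R : Type) := FPS { fcoef :> nat -> R }.

Lemma fpsP (R : Type) (f g : fps R) : f =1 g <-> f = g.
Proof. by split=> [|-> //]; case: f g => [f] [g] /= /funext ->. Qed.

HB.instance Definition _ (R : Type) := gen_eqMixin (fps R).
HB.instance Definition _ (R : Type) := gen_choiceMixin (fps R).

Section FpsRing.
Variable R : comNzRingType.
Implicit Types f g h : fps R.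

Definition fps_zero : fps R := FPS (fun=> 0).
Definition fps_add f g : fps R := FPS (fun n => f n + g n).
Definition fps_opp f : fps R := FPS (fun n => - f n).
Definition fps_one : fps R := FPS (fun n => (n == 0%N)%:R).
Definition fps_mul f g : fps R := FPS (fun n => \sum_(i < n.+1) f i * g (n - i)%N).
Definition fps_scale (a : R) f : fps R := FPS (fun n => a * f n).

Lemma fps_addA : associative fps_add.
Proof. by move=> f g h; apply/fpsP => n /=; rewrite addrA. Qed.
Lemma fps_addC : commutative fps_add.
Proof. by move=> f g; apply/fpsP => n /=; rewrite addrC. Qed.
Lemma fps_add0 : left_id fps_zero fps_add.
Proof. by move=> f; apply/fpsP => n /=; rewrite add0r. Qed.
Lemma fps_addN : left_inverse fps_zero fps_opp fps_add.
Proof. by move=> f; apply/fpsP => n /=; rewrite addNr. Qed.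

HB.instance Definition _ :=
  GRing.isZmodule.Build (fps R) fps_addA fps_addC fps_add0 fps_addN.

Lemma fps_mulC : commutative fps_mul.
Proof.
move=> f g; apply/fpsP => n /=; rewrite (reindex_inj rev_ord_inj) /=.
by apply: eq_bigr => i _; rewrite subSS subKn -1?ltnS // mulrC.
Qed.

Lemma fps_mulA : associative fps_mul.
Proof.
pose tr N f : {poly R} := \poly_(i < N.+1) f i.
have low n (p q : {poly R}) f g :
    (forall i, (i <= n)%N -> p`_i = f i) -> (forall i, (i <= n)%N -> q`_i = g i) ->
    forall i, (i <= n)%N -> (p * q)`_i = fps_mul f g i.
  move=> pf qg i lin; rewrite coefM /=; apply: eq_bigr => j _.
  have ltj := ltn_ord j; rewrite pf ?qg //.
    exact: leq_trans (leq_subr _ _) lin.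
  exact: leq_trans lin.
have trE n f i : (i <= n)%N -> (tr n f)`_i = f i.
  by move=> lin; rewrite coef_poly ltnS lin.
move=> f g h; apply/fpsP => n.
rewrite -(low n (tr n f) (tr n g * tr n h)) //; try exact: trE.
  rewrite mulrA (low n (tr n f * tr n g) (tr n h) (fps_mul f g) h) //.
    exact: low (@trE n f) (@trE n g).
  exact: trE.
exact: low (@trE n g) (@trE n h).
Qed.

Lemma fps_mul1 : left_id fps_one fps_mul.
Proof.
move=> f; apply/fpsP => n /=; rewrite big_ord_recl /= mul1r subn0 big1 ?addr0 //.
by move=> i _; rewrite mul0r.
Qed.

Lemma fps_mulDl : left_distributive fps_mul fps_add.
Proof.
move=> f g h; apply/fpsP => n /=; rewrite -big_split /=.
by apply: eq_bigr => i _; rewrite mulrDl.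
Qed.

Lemma fps_1neq0 : fps_one != fps_zero.
Proof. by apply/eqP => /fpsP/(_ 0%N) /= /eqP; rewrite oner_eq0. Qed.

HB.instance Definition _ := GRing.Zmodule_isComNzRing.Build (fps R)
  fps_mulA fps_mulC fps_mul1 fps_mulDl fps_1neq0.

Lemma fps_scaleA a b f : fps_scale a (fps_scale b f) = fps_scale (a * b) f.
Proof. by apply/fpsP => n /=; rewrite mulrA. Qed.
Lemma fps_scale1 : left_id 1 fps_scale.
Proof. by move=> f; apply/fpsP => n /=; rewrite mul1r. Qed.
Lemma fps_scaleDr : right_distributive fps_scale +%R.
Proof. by move=> a f g; apply/fpsP => n /=; rewrite mulrDr. Qed.
Lemma fps_scaleDl f : {morph fps_scale^~ f : a b / a + b}.
Proof. by move=> a b; apply/fpsP => n /=; rewrite mulrDl. Qed.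

HB.instance Definition _ := GRing.Zmodule_isLmodule.Build R (fps R)
  fps_scaleA fps_scale1 fps_scaleDr fps_scaleDl.

Lemma fps_scaleAl (a : R) (f g : fps R) : a *: (f * g) = (a *: f) * g.
Proof.
apply/fpsP => n; rewrite /= mulr_sumr.
by apply: eq_bigr => i _; rewrite mulrA.
Qed.

HB.instance Definition _ := GRing.Lmodule_isLalgebra.Build R (fps R) fps_scaleAl.
HB.instance Definition _ := GRing.Lalgebra_isComAlgebra.Build R (fps R).

Definition fpsX : fps R := FPS (fun n => (n == 1%N)%:R).

Lemma fcoef0 n : (0 : fps R) n = 0. Proof. by []. Qed.
Lemma fcoef1 n : (1 : fps R) n = (n == 0%N)%:R. Proof. by []. Qed.
Lemma fcoefD (f g : fps R) n : (f + g) n = f n + g n. Proof. by []. Qed.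
Lemma fcoefN (f : fps R) n : (- f) n = - f n. Proof. by []. Qed.
Lemma fcoefB (f g : fps R) n : (f - g) n = f n - g n. Proof. by []. Qed.
Lemma fcoefZ a (f : fps R) n : (a *: f) n = a * f n. Proof. by []. Qed.
Lemma fcoefM (f g : fps R) n : (f * g) n = \sum_(i < n.+1) f i * g (n - i)%N.
Proof. by []. Qed.

Lemma fcoefM0 (f g : fps R) : (f * g) 0%N = f 0%N * g 0%N.
Proof. by rewrite fcoefM big_ord_recl big_ord0 addr0. Qed.

Lemma fcoefXn k n : (fpsX ^+ k) n = (n == k)%:R.
Proof.
elim: k n => [|k IHk] n; first by rewrite expr0.
rewrite exprS fcoefM; case: n => [|n].
  by rewrite big_ord_recl big_ord0 mul0r addr0.
rewrite !big_ord_recl /= mul0r add0r mul1r subSS subn0 IHk eqSS big1 ?addr0 //.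
by move=> i _; rewrite mul0r.
Qed.

(* The sum of a family of series, formed coefficientwise.  As [\sum_(_ \in _)]
   is 0 when the support is infinite, this is the mathematical sum exactly when
   every coefficient is nonzero for only finitely many members, which is
   [fps_summable]. *)
Definition fps_sum (I : choiceType) (F : I -> fps R) : fps R :=
  FPS (fun n => \sum_(i \in [set: I]) F i n).

Definition fps_summable (I : choiceType) (F : I -> fps R) : Prop :=
  forall n, finite_set [set i | F i n != 0].

End FpsRing.

(* The sequence whose n-th term is [step] applied to the list of the terms of
   index < n. *)
Section CourseOfValues.
Variables (R : nzRingType) (step : seq R -> R).

Definition cov_seq (n : nat) : seq R :=
  iter n (fun l => rcons l (step l)) [::].
Definition cov (n : nat) : R := step (cov_seq n).

Lemma size_cov_seq n : size (cov_seq n) = n.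
Proof. by elim: n => //= n IHn; rewrite size_rcons IHn. Qed.

Lemma nth_cov_seq n i : (i < n)%N -> (cov_seq n)`_i = cov i.
Proof.
elim: n => // n IHn; rewrite ltnS leq_eqVlt /= nth_rcons size_cov_seq.
by case/predU1P => [->|lin]; [rewrite ltnn eqxx | rewrite lin IHn].
Qed.

End CourseOfValues.

Section FpsUnit.
Variable R : comUnitRingType.
Implicit Types f g : fps R.

Definition fps_unit : {pred fps R} := fun f => f 0%N \is a GRing.unit.

Definition fps_inv_step f (l : seq R) : R :=
  (f 0%N)^-1 * ((size l == 0%N)%:R - \sum_(i < size l) l`_i * f (size l - i)%N).

Definition fps_inv f : fps R :=
  if fps_unit f then FPS (cov (fps_inv_step f)) else f.

Lemma fps_mulV : {in fps_unit, left_inverse 1 fps_inv *%R}.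
Proof.
move=> f; rewrite unfold_in => uf; apply/fpsP => n.
rewrite /fps_inv /fps_unit uf fcoefM big_ord_recr /= subnn {2}/cov /fps_inv_step.
rewrite size_cov_seq -[_ * f 0%N]mulrC mulVKr // addrC -addrA.
rewrite [X in _ + X](_ : _ = 0) ?addr0 // addrC; apply/eqP; rewrite subr_eq0.
by apply/eqP/eq_bigr => i _; rewrite nth_cov_seq.
Qed.

Lemma fps_unitPl (f g : fps R) : g * f = 1 -> fps_unit f.
Proof.
move=> /fpsP/(_ 0%N); rewrite fcoefM0 fcoef1 eqxx => gf1.
by apply/unitrPr; exists (g 0%N); rewrite mulrC.
Qed.

Lemma fps_inv_out : {in [predC fps_unit], fps_inv =1 id}.
Proof. by move=> f; rewrite /fps_inv inE => /negbTE nuf; rewrite ifF. Qed.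

HB.instance Definition _ := GRing.ComNzRing_hasMulInverse.Build (fps R)
  fps_mulV fps_unitPl fps_inv_out.

Lemma fps_unitE (f : fps R) : (f \is a GRing.unit) = (f 0%N \is a GRing.unit).
Proof. by []. Qed.

(* Square root of a series with constant term 1: comparing the coefficients of
   degree n > 0 in r ^+ 2 = f gives 2 r_n = f_n - \sum_(0 < i < n) r_i r_(n-i).
   See [sqrt_fps0], [sqr_sqrt_fps] and [sqrt_fps_uniq]. *)
Definition sqrt_fps_step f (l : seq R) : R :=
  if l is [::] then 1
  else (f (size l) - \sum_(1 <= i < size l) l`_i * l`_(size l - i)) / 2.

Definition sqrt_fps f : fps R := FPS (cov (sqrt_fps_step f)).

Lemma fcoef_sqr (r : fps R) n : r 0%N = 1 -> (0 < n)%N ->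
  (r ^+ 2) n = 2 * r n + \sum_(1 <= i < n) r i * r (n - i)%N.
Proof.
case: n => // n r01 _; rewrite expr2 fcoefM.
rewrite -(big_mkord xpredT (fun i => r i * r (n.+1 - i)%N)).
rewrite big_nat_recl // big_nat_recr //= r01 mul1r subn0 subnn r01 mulr1.
by rewrite big_add1 /= mulr_natl mulr2n -addrA; congr (_ + _); rewrite addrC.
Qed.

Lemma sqrt_fps0 f : sqrt_fps f 0%N = 1.
Proof. by []. Qed.

Lemma sqr_sqrt_fps f : 2%:R \is a @GRing.unit R -> f 0%N = 1 ->
  sqrt_fps f ^+ 2 = f.
Proof.
move=> u2 f01; apply/fpsP => -[|n].
  by rewrite expr2 fcoefM0 sqrt_fps0 mulr1 f01.
rewrite fcoef_sqr ?sqrt_fps0 //.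
have -> : sqrt_fps f n.+1 =
    (f n.+1 - \sum_(1 <= i < n.+1) sqrt_fps f i * sqrt_fps f (n.+1 - i)%N) / 2.
  rewrite {1}/sqrt_fps [LHS]/= /cov; set l := cov_seq _ _.
  have sl : size l = n.+1 by rewrite size_cov_seq.
  rewrite {1}/sqrt_fps_step; case El: l (sl) => [//|x l'] <-; rewrite -El sl.
  congr ((_ - _) / _); apply: eq_big_nat => i /andP[i0 ltin].
  by rewrite !nth_cov_seq // ltn_subrL i0.
by rewrite mulrC divrK // subrK.
Qed.

Lemma sqrt_fps_uniq f (r : fps R) : 2%:R \is a @GRing.unit R ->
  r 0%N = 1 -> r ^+ 2 = f -> r = sqrt_fps f.
Proof.
move=> u2 r01 rf.
have f01 : f 0%N = 1 by rewrite -rf expr2 fcoefM0 r01 mulr1.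
have sf := sqr_sqrt_fps u2 f01.
have us : (r + sqrt_fps f) \is a GRing.unit.
  by rewrite fps_unitE fcoefD r01 sqrt_fps0.
apply/eqP; rewrite -subr_eq0 -(mulrI_eq0 _ (mulrI us)) mulrC -subr_sqr rf sf.
by rewrite subrr.
Qed.

End FpsUnit.

Lemma unit2_polyrat : 2%:R \is a @GRing.unit {poly rat}.
Proof. by rewrite -polyC_natr poly_unitE size_polyC coefC. Qed.

(** * Integer partitions *)

Definition is_partition (l : seq nat) : bool :=
  sorted geq l && all (leq 1%N) l.

Record intpart := IntPart { parts :> seq nat; partsP : is_partition parts }.

HB.instance Definition _ := [isSub for parts].
HB.instance Definition _ := [Countable of intpart by <:].

Definition largest_part (la : intpart) : nat := head 0%N la.

Definition conj_seq (l : seq nat) : seq nat :=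
  [seq count (leq i) l | i <- iota 1 (head 0%N l)].

Lemma conj_seq_partition l : is_partition l -> is_partition (conj_seq l).
Proof.
move=> _; apply/andP; split.
  rewrite /conj_seq sorted_map.
  apply: (@sub_sorted _ leq); last exact: iota_sorted.
  by move=> i j lij; apply: sub_count => x /=; apply: leq_trans.
apply/allP => x /mapP[i]; rewrite mem_iota => /andP[i1]; rewrite add1n ltnS.
case: l => [|y l] /=; last by move=> liy ->; rewrite liy.
by rewrite leqNgt i1.
Qed.

Definition conj (la : intpart) : intpart :=
  IntPart (conj_seq_partition (partsP la)).

(* Index i here is index i + 1 of the 1-based text; the bound keeps only the
   indices at which both partitions have a part. *)
Definition ds (la : intpart) : nat :=
  count (fun i => nth 0%N la i == nth 0%N (conj la) i)
        (iota 0 (minn (size la) (size (conj la)))).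

Definition sp (la : intpart) : nat :=
  (largest_part la + largest_part (conj la))%N.

Lemma largest_part_conj (la : intpart) : largest_part (conj la) = size la.
Proof.
have /andP[_] := partsP la; rewrite /largest_part /= /conj_seq.
by case: (parts la) => [|[|x] l] //=; rewrite all_count => /eqP->.
Qed.

Lemma finite_sp n : finite_set [set la | sp la = n].
Proof.
pose g (b : n.-bseq 'I_n.+1) : intpart :=
  insubd (IntPart (isT : is_partition [::])) [seq val i | i <- b].
apply: (@sub_finite_set _ _ (g @` [set: n.-bseq 'I_n.+1])%classic); last first.
  exact/finite_image/finite_finset.
move=> la; rewrite /= {1}/sp largest_part_conj => spn.
have szn : (size la <= n)%N by rewrite -spn leq_addl.
have len : all (fun x => x <= n)%N la.
  apply/allP => x xla; rewrite -spn (leq_trans _ (leq_addr _ _)) //.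
  have /andP[+ _] := partsP la; move: xla; rewrite /largest_part.
  case: (parts la) => [//|y l]; rewrite inE => /predU1P[-> //|xl] /= sl.
  have geq_tr : transitive geq by move=> a b c /= ba cb; apply: leq_trans cb ba.
  by have /allP := order_path_min geq_tr sl; apply.
have szb : (size [seq (inord i : 'I_n.+1) | i <- la] <= n)%N by rewrite size_map.
exists (Bseq szb) => //; apply: val_inj; rewrite /g /=.
have -> : [seq val i | i <- [seq (inord i : 'I_n.+1) | i <- la]] = la :> seq nat.
  rewrite -map_comp map_id_in // => x xla /=.
  by rewrite inordK // ltnS (allP len).
by rewrite val_insubd (partsP la).
Qed.

Lemma summable_sp (R : comNzRingType) (w : intpart -> R) :
  fps_summable (fun la => w la *: fpsX R ^+ sp la).
Proof.
move=> n; apply: sub_finite_set (finite_sp n) => la.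
rewrite /mkset fcoefZ fcoefXn.
by case: (eqVneq n (sp la)) => // _; rewrite mulr0 eqxx.
Qed.

Lemma sqr_sqrt_1m4X2 :
  sqrt_fps (1 - 4 * fpsX {poly rat} ^+ 2) ^+ 2 = 1 - 4 * fpsX {poly rat} ^+ 2.
Proof.
by apply: sqr_sqrt_fps; rewrite ?unit2_polyrat // fcoefB fcoefM0 fcoefXn mulr0 subr0.
Qed.

Lemma denominator_unit (a : {poly rat}) (z := fpsX {poly rat}) :
  (1 - 2 * z) * (2 * a%:A * z ^+ 2 + sqrt_fps (1 - 4 * z ^+ 2)) \is a GRing.unit.
Proof.
have z0 : z 0%N = 0 by [].
rewrite fps_unitE fcoefM0 fcoefB fcoefD !fcoefM0 sqrt_fps0 z0.
by rewrite !(mulr0, mul0r) subr0 add0r mulr1 unitr1.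
Qed.

(* Main.v *)
(* Cut the boundary path of a nonempty partition where it crosses the main
   diagonal, and reflect the lower half.  This gives two lattice paths from a
   common point, with equally many vertical steps and each ending with one; the
   degree of symmetry is the number of steps the two paths share.  Reading both
   paths simultaneously, their offset performs a lazy walk on the integers.
   Writing t = s - 1, where t marks selected shared steps, and decomposing at
   the first selected step, the generating function K of the pairs satisfies
   r K = r / (1 - 2 z) + t (1 + 2 z^2 K) with r = sqrt (1 - 4 z^2): the lazy
   walks returning to 0 are counted by 1 / r, and all pairs by 1 / (1 - 2 z)
   when s = 1.  The final vertical steps are left out of K, which turns the
   series of the theorem into 1 + z^2 K. *)
Require Import Defs.
From mathcomp Require Import all_boot all_order all_algebra.
From mathcomp Require Import classical_sets fsbigop.
From mathcomp Require Import zify ring.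

Set Implicit Arguments.
Unset Strict Implicit.
Unset Printing Implicit Defensive.

Import GRing.Theory.
Local Open Scope ring_scope.

(** * Boundary words of partitions *)

(* [q] is the boundary of the Young diagram read from its top right end to its
   bottom left end, [true] standing for a vertical step. *)
Fixpoint rows (q : seq bool) : seq nat :=
  if q is x :: q' then if x then count negb q' :: rows q' else rows q' else [::].

Lemma rows_cat q1 q2 :
  rows (q1 ++ q2) = map (addn (count negb q2)) (rows q1) ++ rows q2.
Proof.
by elim: q1 => //= -[] q1 IH //=; rewrite IH count_cat addnC.
Qed.

Lemma rows_rconsT q : rows (rcons q true) = rcons (rows q) 0%N.
Proof. by rewrite -!cats1 rows_cat /= (eq_map add0n) map_id. Qed.

Lemma rows_rconsF q : rows (rcons q false) = map succn (rows q).
Proof. by rewrite -cats1 rows_cat cats0. Qed.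

Lemma size_rows q : size (rows q) = count id q.
Proof. by elim: q => //= -[] q IH //=; rewrite IH. Qed.

Lemma rows_le q : all (geq (count negb q)) (rows q).
Proof.
elim: q => //= -[] q IH /=; first by rewrite leqnn.
by apply: sub_all IH => i /= /leqW.
Qed.

Lemma rows_sorted q : sorted geq (rows q).
Proof.
have geq_tr : transitive geq by move=> a b c /= ba cb; apply: leq_trans cb ba.
elim: q => //= -[] q IH //=.
by rewrite path_sortedE // rows_le.
Qed.

Lemma rows_partition r : is_partition (rows (true :: rcons r false)).
Proof.
by rewrite /is_partition rows_sorted -rcons_cons rows_rconsF all_map; apply/allP.
Qed.

(** The boundary of a nonempty partition starts with a vertical step and ends with a horizontal one;
    [r] is what lies between. *)
Definition path_part (r : seq bool) : intpart := IntPart (rows_partition r).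

Fixpoint unrows (l : seq nat) : seq bool :=
  if l is x :: l' then true :: nseq (x - head 0%N l') false ++ unrows l' else [::].

(** Horizontal steps before the first vertical one leave no trace in [rows q], so the prefix
    restores them. *)
Lemma rowsK q : nseq (count negb q - head 0%N (rows q)) false ++ unrows (rows q) = q.
Proof.
elim: q => //= -[] q IH; first by rewrite add0n subnn /= IH.
rewrite add1n subSn /= ?IH //; have := rows_le q.
by case: (rows q) => //= a l /andP[].
Qed.

Lemma unrowsK l : sorted geq l -> 
  count negb (unrows l) = head 0%N l /\ rows (unrows l) = l.
Proof.
elim: l => //= x l IH xl; have [cl rl] := IH (path_sorted xl).
have lex : (head 0%N l <= x)%N by case: l xl {IH cl rl} => //= y l /andP[].
rewrite rows_cat count_cat count_nseq mul1n cl add0n subnK //; split=> //.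
have -> : rows (nseq (x - head 0%N l) false) = [::] by elim: (x - _)%N.
by rewrite rl.
Qed.

Lemma path_part_inj : injective path_part.
Proof.
move=> r1 r2 /(congr1 parts) /= [h1 h2].
have := rowsK (rcons r1 false); rewrite h1 h2 (rowsK (rcons r2 false)).
by move=> /rcons_inj [].
Qed.

Lemma path_part_surj (la : intpart) : parts la != [::] ->
  exists r, la = path_part r.
Proof.
case: la => l lP /= l0; have /andP[ls l1] := lP.
have [_ rl] := unrowsK ls.
suff [r rE] : exists r, unrows l = true :: rcons r false.
  by exists r; apply: val_inj; rewrite /= -[LHS]rl rE.
(* A final vertical step would create a part equal to 0. *)
have nT q : unrows l != rcons q true.
  apply/eqP => uE; move: l1; rewrite -rl uE rows_rconsT all_rcons ltnn //.
case: l l0 {lP ls l1 rl} nT => //= x l _.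
case/lastP: (_ ++ _) => [|u b] nT; first by have := nT [::]; rewrite eqxx.
by case: b nT => nT; [have := nT (true :: u); rewrite eqxx | exists u].
Qed.

Definition flip (q : seq bool) : seq bool := rev (map negb q).

(** Induction on the last step: a vertical one adds an empty row, invisible to the column counts; a
    horizontal one adds a column of full height in front. *)
Lemma conj_rows q : conj_seq (rows (true :: q)) = rows (flip (true :: q)).
Proof.
elim/last_ind: q => // q [] IH.
  rewrite -rcons_cons /flip map_rcons rev_rcons [RHS]/= -/(flip _) -IH.
  rewrite rows_rconsT /conj_seq /=.
  apply/eq_in_map => i; rewrite mem_iota => /andP[i1 _].
  by rewrite -cats1 count_cat /= [(i <= 0)%N]leqNgt i1 !addn0.
rewrite -rcons_cons /flip map_rcons rev_rcons [RHS]/= -/(flip _) -IH.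
rewrite rows_rconsF /conj_seq [head _ _]/= -[iota _ _.+1]/(1%N :: iota 2 _).
rewrite map_cons; congr (_ :: _).
  rewrite count_map (eq_count (a2 := predT)) // count_predT size_rows.
  rewrite count_rev [RHS]/= count_map; congr (_ + _)%N; apply: eq_count => b /=.
  by rewrite negbK.
by rewrite -[2%N]/(1 + 1)%N iotaDl -map_comp; apply: eq_map => i /=;
   rewrite count_map.
Qed.

Lemma sp_path_part r : sp (path_part r) = (size r).+2.
Proof.
rewrite /sp largest_part_conj /largest_part /= size_rows.
by rewrite addnS -(size_rcons r false) -(count_predC id (rcons r false)) addnC.
Qed.

(** * Entrywise agreement of sequences *)

Definition agree (s t : seq nat) : nat := count (fun p => p.1 == p.2) (zip s t).

Lemma ds_agree (la : intpart) : ds la = agree la (Defs.conj la).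
Proof.
rewrite /ds; move: (parts (Defs.conj la)) => t.
elim: (parts la) t => [|x s IH] [|y t] //=.
rewrite minnSS /= /agree /= -/(agree s t) -IH; congr (_ + _)%N.
by rewrite -[1%N]/(1 + 0)%N iotaDl count_map.
Qed.

Lemma agree_cat s1 s2 t1 t2 : size s1 = size t1 ->
  agree (s1 ++ s2) (t1 ++ t2) = (agree s1 t1 + agree s2 t2)%N.
Proof. by move=> e; rewrite /agree zip_cat // count_cat. Qed.

Lemma agree_map (f : nat -> nat) s t :
  {in s & t, forall i j, f i = f j -> i = j} -> agree (map f s) (map f t) = agree s t.
Proof.
elim: s t => [|x s IH] [|y t] //= fI; rewrite /agree /= -/(agree s t) -IH; last first.
  by move=> i j si tj; apply: fI; rewrite inE ?si ?tj orbT.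
congr (nat_of_bool _ + _)%N; apply/eqP/eqP => [|-> //].
by apply: fI; rewrite inE eqxx.
Qed.

Lemma agree_rev s t : size s = size t -> agree (rev s) (rev t) = agree s t.
Proof. by move=> e; rewrite /agree -rev_zip // count_rev. Qed.

Lemma agreeC s t : agree s t = agree t s.
Proof.
by elim: s t => [|x s IH] [|y t] //=; rewrite /agree /= eq_sym -/(agree s t) IH.
Qed.

Lemma agree_disjoint s t u : {in s & u, forall i j, i != j} ->
  agree s (t ++ u) = agree s t.
Proof.
elim: s t u => [|x s IH] [|y t] u //= su; rewrite /agree /=; last first.
- by congr (_ + _)%N; apply: IH => i j si; apply: su; rewrite inE si orbT.
- case: u su => //= y u su; rewrite (negPf (su x y _ _)) ?inE ?eqxx //=.
  rewrite -[LHS]/(agree s ([::] ++ u)) IH; first by case: (s).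
  by move=> i j si uj; apply: su; rewrite inE ?si ?uj orbT.
by case: (u).
Qed.

(** * Positions of steps in a path *)

Fixpoint before (x : bool) (k : nat) (v : seq bool) : seq nat :=
  if v is y :: v' then if y == x then k :: before x k v' else before x k.+1 v'
  else [::].

Fixpoint index_of (x : bool) (k : nat) (v : seq bool) : seq nat :=
  if v is y :: v' then if y == x then k :: index_of x k.+1 v' else index_of x k.+1 v'
  else [::].

(** The [i]-th step of kind [x], counted from 0, sits at position [i] plus the number of opposite
    steps before it. Adding [i] to the [i]-th entry on both sides preserves agreement. *)
Lemma agree_before x v w :
  agree (before x 0 v) (before x 0 w) = agree (index_of x 0 v) (index_of x 0 w).
Proof.
pose fix shift j s := if s is i :: s' then (i + j)%N :: shift j.+1 s' else [::].
have shiftE k j u : shift j (before x k u) = index_of x (k + j) u.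
  by elim: u k j => //= y u IH k j; case: ifP => _ /=; rewrite IH ?addnS.
have agree_shift j s t : agree (shift j s) (shift j t) = agree s t.
  elim: s t j => [|i s IH] [|i' t] j //=; rewrite /agree /= -/(agree _ _) IH.
  by rewrite eqn_add2r.
by rewrite -(agree_shift 0%N) !shiftE.
Qed.

Lemma rows_rev v : rows (rev v) = rev (before true 0 v).
Proof.
have beforeS k u : before true k.+1 u = map succn (before true k u).
  by elim: u k => //= -[] u IH k //=; rewrite IH.
elim: v => //= -[] v IH; rewrite rev_cons.
  by rewrite rows_rconsT IH rev_cons.
by rewrite rows_rconsF IH beforeS map_rev.
Qed.

Lemma rows_negb v : rows (map negb v) = map (subn (count id v)) (before false 0 v).
Proof.
suff E k : rows (map negb v) = map (subn (k + count id v)) (before false k v).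
  exact: E 0%N.
elim: v k => //= -[] v IH k /=.
  by rewrite (IH k.+1) add1n addnS.
rewrite -IH add0n addnC addnK; congr (_ :: _).
by rewrite count_map; apply: eq_count => b /=; rewrite negbK.
Qed.

Lemma size_before x k v : size (before x k v) = count (pred1 x) v.
Proof. by elim: v k => //= y v IH k; case: eqP => _ /=; rewrite IH. Qed.

Lemma before_le v i : i \in before false 0 v -> (i <= count id v)%N.
Proof.
suff E k : i \in before false k v -> (i <= k + count id v)%N by exact: E 0%N.
elim: v k => //= -[] v IH k /=; first by move/IH; rewrite addSnnS.
by rewrite inE => /predU1P[-> | /IH //]; rewrite leq_addr.
Qed.

(** * Degree of symmetry as a number of shared steps *)

(* [d] is the number of vertical steps of the first path minus that of the
   second. *)
Fixpoint common (d : int) (v w : seq bool) : nat :=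
  match v, w with
  | x :: v', y :: w' =>
      ((d == 0) && (x == y)) + common (d + (x : nat)%:Z - (y : nat)%:Z) v' w'
  | _, _ => 0
  end.

Lemma agree_rconsl k s t : all (gtn k) t -> agree (rcons s k) t = agree s t.
Proof.
move=> /allP tk; rewrite agreeC -cats1 agree_disjoint 1?agreeC // => i j it.
by rewrite inE => /eqP ->; have /= := tk _ it; rewrite ltn_neqAle => /andP[].
Qed.

(** As [k] exceeds all earlier entries, its two copies can only match each other, which requires the
    same index. *)
Lemma agree_rcons k s t : all (gtn k) s -> all (gtn k) t ->
  agree (rcons s k) (rcons t k) = ((size s == size t) + agree s t)%N.
Proof.
elim: s t => [|x s IH] [|y t] //=.
- by rewrite /agree /= eqxx.
- by move=> _ /andP[yk _]; rewrite /agree /= gtn_eqF //; case: (rcons t k).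
- by move=> /andP[xk _] _; rewrite /agree /= ltn_eqF //; case: (rcons s k).
move=> /andP[_ sk] /andP[_ tk].
by rewrite /agree /= -!/(agree _ _) IH // eqSS addnCA.
Qed.

Lemma index_of_ge x k v : all (leq k) (index_of x k v).
Proof.
elim: v k => //= y v IH k.
have {}IH : all (leq k) (index_of x k.+1 v) by apply: sub_all (IH k.+1) => i /ltnW.
by case: ifP => //= _; rewrite leqnn.
Qed.

(* [h1], [h2] (resp. [g1], [g2]) are the positions of the vertical (resp.
   horizontal) steps already read.  An entry of the longer history that has no
   partner yet is smaller than every later position, so it never meets an equal
   partner. *)
Lemma agree_common_aux k h1 h2 g1 g2 v w :
    all (gtn k) h1 -> all (gtn k) h2 -> all (gtn k) g1 -> all (gtn k) g2 ->
    (size h1 + size g1 = size h2 + size g2)%N ->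
  (agree (h1 ++ index_of true k v) (h2 ++ index_of true k w)
   + agree (g1 ++ index_of false k v) (g2 ++ index_of false k w)
   = common ((size h1)%:Z - (size h2)%:Z) v w + (agree h1 h2 + agree g1 g2))%N.
Proof.
have disj x k' (h t : seq nat) u : all (gtn k') h ->
    agree h (t ++ index_of x k' u) = agree h t.
  move=> /allP hk; apply: agree_disjoint => i j /hk /= ik.
  by move/(allP (index_of_ge x k' u)) => kj; rewrite ltn_eqF // (leq_trans ik).
have up k' h : all (gtn k') h -> all (gtn k'.+1) h.
  by apply: sub_all => i /ltnW.
have upr k' h : all (gtn k') h -> all (gtn k'.+1) (rcons h k').
  by rewrite all_rcons /= ltnS leqnn => /up.
elim: v w k h1 h2 g1 g2 => [|x v IH] w k h1 h2 g1 g2 h1k h2k g1k g2k e.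
  by rewrite /= !cats0 !disj.
case: w => [|y w].
  rewrite (agreeC (h1 ++ _)) (agreeC (g1 ++ _)) [common _ _ _]/=.
  rewrite [index_of true k [::]]/= [index_of false k [::]]/= !cats0 !disj //.
  by rewrite (agreeC h2) (agreeC g2).
have e' : (size h1 == size h2) = (size g1 == size g2) by lia.
have [d dE] : exists d, d = (size h1)%:Z - (size h2)%:Z + (x : nat)%:Z - (y : nat)%:Z.
  by eexists.
rewrite [common _ _ _]/= -dE.
case: x y dE => -[] dE; rewrite /= -?cat_rcons IH ?size_rcons ?upr ?up //; try lia.
- have -> : (size h1).+1%:Z - (size h2).+1%:Z = d by lia.
  by rewrite agree_rcons //; lia.
- have -> : (size h1).+1%:Z - (size h2)%:Z = d by lia.
  by rewrite agree_rconsl // [agree g1 _]agreeC agree_rconsl // [agree g2 _]agreeC; lia.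
- have -> : (size h1)%:Z - (size h2).+1%:Z = d by lia.
  by rewrite agree_rconsl // [agree h1 _]agreeC agree_rconsl // [agree h2 _]agreeC; lia.
have -> : (size h1)%:Z - (size h2)%:Z = d by lia.
by rewrite agree_rcons //; lia.
Qed.

Lemma agree_common v w :
  (agree (before true 0 v) (before true 0 w)
   + agree (before false 0 v) (before false 0 w))%N = common 0 v w.
Proof.
by rewrite !agree_before (@agree_common_aux 0 [::] [::] [::] [::]) // subrr addn0.
Qed.

(* The boundary is cut where it crosses the main diagonal: [v] and [w] are the
   two halves read from the diagonal outwards, the second one reflected.  Both
   have as many vertical steps ([true]) as the side of the Durfee square, so
   row [i] and column [i] are compared through vertical steps when [i] meets the
   Durfee square and through horizontal steps otherwise. *)
Lemma ds_path_part v w : count id v = count id w ->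
  ds (path_part (catrev v (map negb w))) = common 0 (rcons v true) (rcons w true).
Proof.
move=> e; set v' := rcons v true; set w' := rcons w true.
have e' : count id v' = count id w' by rewrite /v' /w' -!cats1 !count_cat e.
(* The two forced end steps of the boundary become the final vertical steps of the two halves. *)
have splitE : true :: rcons (catrev v (map negb w)) false = rev v' ++ map negb w'.
  by rewrite catrevE rcons_cat rev_rcons map_rcons.
have countN u : count negb (map negb u) = count id u.
  by rewrite count_map; apply: eq_count => b /=; rewrite negbK.
have size_rows_rev u : size (rows (rev u)) = count id u.
  by rewrite size_rows count_rev.
rewrite ds_agree /= conj_rows /flip.
rewrite -[count negb _ :: _]/(rows (true :: _)) splitE map_cat rev_cat -!map_rev.
rewrite revK -map_comp (eq_map negbK) map_id !rows_cat !countN -e'.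
rewrite agree_cat ?size_map ?size_rows_rev // agree_map; last first.
  by move=> i j _ _ /addnI.
rewrite !rows_rev agree_rev ?size_before; last first.
  by rewrite !(eq_count (a2 := id)) // => -[].
(* Truncated subtraction is injective here because no entry exceeds the minuend. *)
rewrite !rows_negb e' agree_map => [|i j /before_le + /before_le]; last first.
  by rewrite e'; lia.
by rewrite (agreeC (before false _ w')) agree_common.
Qed.

(** * Sums over words *)

Fixpoint words (n : nat) : seq (seq bool) :=
  if n is m.+1 then map (cons true) (words m) ++ map (cons false) (words m)
  else [:: [::]].

Lemma mem_words n r : (r \in words n) = (size r == n).
Proof.
elim: n r => [|n IH] [|x r] //=.
  by rewrite mem_cat; apply/negP => /orP[] /mapP[].
rewrite mem_cat eqSS -IH; apply/orP/idP => [[] /mapP[r' ? [_ ->]] //|rn].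
by case: x; [left | right]; apply: map_f.
Qed.

Lemma words_uniq n : uniq (words n).
Proof.
elim: n => //= n IH; rewrite cat_uniq !map_inj_uniq ?IH => [|r s []|r s []] //.
by rewrite andbT; apply/hasPn => _ /mapP[r _ ->]; apply/negP => /mapP[].
Qed.

Section WordSums.
Variable R : comNzRingType.

Lemma words0_sum (F : seq bool -> R) : \sum_(v <- words 0) F v = F [::].
Proof. exact: big_seq1. Qed.

Lemma wordsS_sum n (F : seq bool -> R) :
  \sum_(v <- words n.+1) F v =
  \sum_(v <- words n) F (true :: v) + \sum_(v <- words n) F (false :: v).
Proof. by rewrite big_cat !big_map. Qed.

Lemma words_catrev_sum a b (F : seq bool -> R) :
  \sum_(r <- words (a + b)) F r =
  \sum_(v <- words a) \sum_(w <- words b) F (catrev v (map negb w)).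
Proof.
elim: a b F => [|a IH] b F.
  rewrite words0_sum /=; elim: b F => [|b IHb] F; first by rewrite !words0_sum.
  by rewrite !wordsS_sum addrC; congr (_ + _); apply: IHb.
rewrite addSnnS IH wordsS_sum -big_split; apply: eq_bigr => v _ /=.
by rewrite wordsS_sum addrC.
Qed.

(** Each word has exactly one cut whose halves have equally many vertical steps after reflection:
    the suffix length [b] must be the number of vertical steps of the whole word. *)
Lemma words_diagonal_sum n (F : seq bool -> R) :
  \sum_(r <- words n) F r =
  \sum_(b < n.+1) \sum_(v <- words (n - b)) \sum_(w <- words b)
    if count id v == count id w then F (catrev v (map negb w)) else 0.
Proof.
transitivity (\sum_(b < n.+1) \sum_(r <- words n) if count id r == b then F r else 0).
  rewrite exchange_big big_seq [RHS]big_seq; apply: eq_bigr => r.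
  rewrite mem_words => /eqP rn; have cn : (count id r < n.+1)%N.
    by rewrite ltnS -rn count_size.
  by rewrite -big_mkcond (big_pred1 (Ordinal cn)).
apply: eq_bigr => b _.
rewrite -{1}(subnK (leq_ord b)) words_catrev_sum.
apply: eq_bigr => v _; apply: eq_big_seq => w; rewrite mem_words => /eqP wb.
congr (if _ then _ else _); rewrite catrevE count_cat count_rev count_map.
have := count_predC id w; rewrite wb.
have -> : count (predC id) w = count (preim negb id) w by exact: eq_count.
by lia.
Qed.

Arguments words : simpl never.

(** * Weighted pairs of paths *)

(* The last vertical step of each path is not part of [v] and [w]. *)
Definition weight (s : R) (d : int) (v w : seq bool) : R :=
  if d + count id v == count id w then s ^+ common d (rcons v true) (rcons w true)
  else 0.

Lemma weight_nil2 s d : weight s d [::] [::] = if d == 0 then s else 0.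
Proof. by rewrite /weight /= addr0; case: eqP. Qed.

(** The first path has only its final vertical step left. Sharing it needs [d = 0] and [y = true],
    which the equality of vertical counts excludes. *)
Lemma weight_nill s d y w : weight s d [::] (y :: w) = weight 1 d [::] (y :: w).
Proof.
rewrite /weight /= expr1n; case: eqP => //= dw.
case: eqP dw => [->|_ _]; last by rewrite expr0.
by case: y => //=.
Qed.

Lemma weight_nilr s d x v : weight s d (x :: v) [::] = weight 1 d (x :: v) [::].
Proof.
rewrite /weight /= expr1n; case: eqP => //= dw.
case: eqP dw => [->|_ _]; last by case: v.
by case: x; case: v => //=.
Qed.

Lemma weight_cons s d x v y w :
  weight s d (x :: v) (y :: w) =
  (if (d == 0) && (x == y) then s else 1)
  * weight s (d + (x : nat)%:Z - (y : nat)%:Z) v w.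
Proof.
rewrite /weight [count id _]/= [count id (y :: w)]/=.
have -> : (d + (x + count id v)%N == (y + count id w)%N :> int) =
          (d + (x : nat)%:Z - (y : nat)%:Z + count id v == count id w :> int) by lia.
case: ifP => _; last by rewrite mulr0.
by rewrite /= exprD; case: (_ && _).
Qed.

(** The theorem concerns [d = 0], but removing first steps couples neighbouring offsets. *)
Definition pairs (s : R) (d : int) : fps R :=
  FPS (fun n => \sum_(b < n.+1) \sum_(v <- words (n - b)) \sum_(w <- words b)
    weight s d v w).

Lemma fcoef_pairs s d n :
  pairs s d n =
  \sum_(b < n.+1) \sum_(v <- words (n - b)) \sum_(w <- words b) weight s d v w.
Proof. by []. Qed.

Lemma pairs0 s d : pairs s d 0%N = if d == 0 then s else 0.
Proof. by rewrite /= big_ord1 !words0_sum weight_nil2. Qed.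

Lemma pairs1 s d : pairs s d 1%N = pairs 1 d 1%N.
Proof.
rewrite /= !big_ord_recl !big_ord0 /= !(wordsS_sum, words0_sum).
by rewrite !(weight_nill s) !(weight_nilr s).
Qed.

(** Remove the first step of both paths. Pairs with an empty word form [edge], independent of [s],
    and cancel in the difference. *)
Lemma pairsSS s d n : pairs s d n.+2 - pairs 1 d n.+2 =
  ((if d == 0 then s else 1) * pairs s d n - pairs 1 d n) *+ 2
  + (pairs s (d + 1) n - pairs 1 (d + 1) n)
  + (pairs s (d - 1) n - pairs 1 (d - 1) n).
Proof.
pose edge := \sum_(v <- words n.+2) weight 1 d v [::]
             + \sum_(w <- words n.+2) weight 1 d [::] w.
have E u : pairs u d n.+2 = edge + (((if d == 0 then u else 1) * pairs u d n) *+ 2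
    + pairs u (d + 1) n + pairs u (d - 1) n).
  rewrite fcoef_pairs big_ord_recl big_ord_recr /=.
  rewrite subn0 /bump leq0n add1n subnn words0_sum.
  under eq_bigr do rewrite words0_sum.
  have -> : \sum_(v <- words n.+2) weight u d v [::] =
            \sum_(v <- words n.+2) weight 1 d v [::].
    by rewrite !(wordsS_sum n.+1);
       congr (_ + _); apply: eq_bigr => v _; exact: weight_nilr.
  have -> : \sum_(w <- words n.+2) weight u d [::] w =
            \sum_(w <- words n.+2) weight 1 d [::] w.
    by rewrite !(wordsS_sum n.+1);
       congr (_ + _); apply: eq_bigr => v _; exact: weight_nill.
  rewrite addrA addrAC; congr (_ + _).
  rewrite mulr_sumr -sumrMnl -!big_split /=; apply: eq_bigr => b _.
  rewrite add1n subSS subSn ?leq_ord // (wordsS_sum (n - b)) -!big_split /=.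
  rewrite mulr_sumr -sumrMnl -!big_split /=; apply: eq_bigr => v _.
  rewrite !(wordsS_sum b) mulr_sumr -sumrMnl -!big_split /=; apply: eq_bigr => w _.
  rewrite !weight_cons.
  have -> : d + (true : nat)%:Z - (true : nat)%:Z = d by lia.
  have -> : d + (false : nat)%:Z - (false : nat)%:Z = d by lia.
  have -> : d + (true : nat)%:Z - (false : nat)%:Z = d + 1 by lia.
  have -> : d + (false : nat)%:Z - (true : nat)%:Z = d - 1 by lia.
  by rewrite /= !andbT !andbF !mul1r; ring.
rewrite !E if_same mul1r !mulr2n.
by ring.
Qed.

Lemma pairs_all n : pairs 1 0 n = \sum_(r <- words n) 1.
Proof.
rewrite words_diagonal_sum /=; apply: eq_bigr => b _; apply: eq_bigr => v _.
by apply: eq_bigr => w _; rewrite /weight add0r expr1n eqz_nat.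
Qed.

End WordSums.

(** * Coefficient rules and uniqueness for the walk recurrence *)

Section FpsCoefficients.
Variable R : comNzRingType.
Implicit Types f g : fps R.
Local Notation z := (fpsX R).

Lemma fcoef_natM k f n : (k%:R * f) n = k%:R * f n.
Proof. by rewrite !mulr_natl; elim: k => // k IH; rewrite !mulrS fcoefD IH. Qed.

Lemma fcoef_algM (a : R) f n : (a%:A * f) n = a * f n.
Proof. by rewrite mulr_algl. Qed.

Lemma fcoefXM f n : (z * f) n = if n is m.+1 then f m else 0.
Proof.
rewrite fcoefM big_ord_recl /= mul0r add0r; case: n => [|n]; first by rewrite big_ord0.
by rewrite big_ord_recl /= subSS subn0 mul1r big1 ?addr0 // => i _; rewrite mul0r.
Qed.

Lemma fcoefX2M f n : (z ^+ 2 * f) n = if n is m.+2 then f m else 0.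
Proof. by rewrite expr2 -mulrA fcoefXM; case: n => // n; rewrite fcoefXM. Qed.

Lemma fpsX2_inj f g : z ^+ 2 * f = z ^+ 2 * g -> f = g.
Proof. by move/fpsP => E; apply/fpsP => n; have := E n.+2; rewrite !fcoefX2M. Qed.

(** The factor [z ^+ 2] expresses each coefficient through coefficients two degrees lower. *)
Lemma lazy_walk_uniq (U : int -> fps R) :
  (forall d, U d = z ^+ 2 * (2 * U d + U (d + 1) + U (d - 1))) -> forall d, U d = 0.
Proof.
move=> UE d; apply/fpsP => n; elim/ltn_ind: n d => n IH d.
rewrite UE fcoefX2M; case: n IH => [|[|n]] IH //.
by rewrite !fcoefD fcoef_natM !IH // mulr0 !addr0.
Qed.

Lemma pairs_all_gf : (1 - 2 * z) * pairs 1 0 = 1.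
Proof.
rewrite mulrBl mul1r -mulrA; apply/fpsP => n.
rewrite fcoefB fcoef_natM fcoefXM pairs_all fcoef1; case: n => [|n].
  by rewrite words0_sum mulr0 subr0.
by rewrite pairs_all wordsS_sum mulr_natl mulr2n subrr.
Qed.

End FpsCoefficients.

(** * Solution of the lazy walk recurrence *)

Section LazyWalk.
Variable R : comUnitRingType.
Hypothesis unit2 : 2%:R \is a @GRing.unit R.
Local Notation z := (fpsX R).
Local Notation r := (sqrt_fps (1 - 4 * z ^+ 2)).

Lemma sqr_r : r ^+ 2 = 1 - 4 * z ^+ 2.
Proof. by apply: sqr_sqrt_fps; rewrite // fcoefB fcoef_natM fcoefXn mulr0 subr0. Qed.

Lemma r_unit : r \is a GRing.unit.
Proof. by rewrite fps_unitE sqrt_fps0 unitr1. Qed.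

Lemma fps_unit2 : 2%:R \is a @GRing.unit (fps R).
Proof. by rewrite fps_unitE -[2%:R]mulr1 fcoef_natM mulr1. Qed.

(* [rho] counts the lazy walks from [1] to [0] that stop at their first visit to
   [0]. *)
Lemma descent_gf : exists rho : fps R,
  2 * z ^+ 2 * rho = 1 - 2 * z ^+ 2 - r /\ rho = z ^+ 2 * (1 + rho) ^+ 2.
Proof.
have r1 : r 1%N = 0.
  have /fpsP/(_ 1%N) := sqr_r.
  rewrite fcoef_sqr // big_geq // addr0 fcoefB fcoef_natM fcoefXn mulr0 subr0.
  by move/eqP; rewrite mulrI_eq0 => [/eqP //|]; apply: mulrI.
pose rho : fps R := FPS (fun n => 2^-1 * (1 - 2 * z ^+ 2 - r) n.+2).
have rhoE : 2 * z ^+ 2 * rho = 1 - 2 * z ^+ 2 - r.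
  apply/fpsP => n; rewrite -mulrA fcoef_natM fcoefX2M.
  case: n => [|[|n]]; last by rewrite mulVKr.
  - by rewrite !fcoefB fcoef_natM fcoefXn sqrt_fps0 mulr0 subr0 subrr.
  - by rewrite !fcoefB fcoef_natM fcoefXn r1 !mulr0 !subr0.
exists rho; split=> //.
(* Multiplied by [4 * z ^+ 2], the quadratic equation becomes [sqr_r] for
   [r = 1 - 2 * z ^+ 2 * (1 + rho)]. *)
apply: fpsX2_inj; apply: (mulrI fps_unit2); apply: (mulrI fps_unit2).
have rE : r = 1 - 2 * z ^+ 2 - 2 * z ^+ 2 * rho by rewrite rhoE; ring.
have := sqr_r; rewrite {1}rE => sq.
transitivity ((1 - 2 * z ^+ 2 * (1 + rho)) ^+ 2 - 1 + 4 * z ^+ 2 * (1 + rho)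
  + (1 - 4 * z ^+ 2 - (1 - 2 * z ^+ 2 - 2 * z ^+ 2 * rho) ^+ 2));
  last by rewrite sq; ring.
ring.
Qed.

(** A walk from [d] to 0 makes [|d|] first descents, each counted by [rho], followed by a walk from
    0 to 0, counted by [r^-1]. *)
Lemma lazy_walk_gf : exists A : int -> fps R, A 0 = r^-1 /\
  forall d, A d = (d == 0)%:R + z ^+ 2 * (2 * A d + A (d + 1) + A (d - 1)).
Proof.
have [rho [rhoE rho_eq]] := descent_gf.
exists (fun d => rho ^+ `|d|%N / r); split; first by rewrite expr0 mul1r.
have step n : rho ^+ n.+1 / r =
    z ^+ 2 * (2 * (rho ^+ n.+1 / r) + rho ^+ n.+2 / r + rho ^+ n / r).
  by rewrite {1}exprS {1}rho_eq !exprS; ring.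
case=> [[|n]|n].
- rewrite eqxx !expr0 expr1 /=.
  transitivity (1 + (2 * z ^+ 2 + 2 * z ^+ 2 * rho) / r); last by ring.
  transitivity (1 + 1 / r - r / r); first by rewrite divrr ?r_unit //; ring.
  by rewrite rhoE; ring.
- have -> : (n.+1%:Z == 0) = false by [].
  have -> : absz (n.+1%:Z + 1) = n.+2 by lia.
  have -> : absz (n.+1%:Z - 1) = n by lia.
  by rewrite mulr0n add0r; exact: step.
have -> : (Negz n == 0) = false by [].
have -> : absz (Negz n) = n.+1 by lia.
have -> : absz (Negz n + 1) = n by lia.
have -> : absz (Negz n - 1) = n.+2 by lia.
by rewrite mulr0n add0r addrAC; exact: step.
Qed.

(* As functions of [d], the difference [pairs s d - pairs 1 d] and [A d * Y] solve
   the same lazy walk recurrence with source [Y] at [0]. *)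
Lemma pairs_gf (s : R) (c := (1 - s)%:A) :
  (1 - 2 * z) * (2 * c * z ^+ 2 + r) * pairs s 0 = r - c * (1 - 2 * z).
Proof.
have [A [A0 AE]] := lazy_walk_gf.
(* The source: [1] stands for two empty words, whose final steps coincide, and [2 * z ^+ 2] for a
   shared first step of either kind. *)
pose Y := - c * (1 + 2 * z ^+ 2 * pairs s 0).
have YE n : Y n =
    (s - 1) * ((n == 0%N)%:R + 2 * if n is m.+2 then pairs s 0 m else 0).
  rewrite /Y mulNr fcoefN fcoef_algM [X in _ * X]fcoefD fcoef1 -mulrA fcoef_natM.
  by rewrite fcoefX2M -mulNr opprB.
have DE d : pairs s d - pairs 1 d = (d == 0)%:R * Y +
    z ^+ 2 * (2 * (pairs s d - pairs 1 d) + (pairs s (d + 1) - pairs 1 (d + 1))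
              + (pairs s (d - 1) - pairs 1 (d - 1))).
  apply/fpsP => n; rewrite [RHS]fcoefD fcoef_natM fcoefX2M YE.
  case: n => [|[|n]].
  - by rewrite fcoefB !pairs0; case: eqP => _ /=; ring.
  - by rewrite fcoefB (pairs1 s) /=; ring.
  rewrite fcoefB pairsSS !fcoefD fcoef_natM !fcoefD !fcoefN.
  by case: eqP => [-> | _] /=; ring.
have E : pairs s 0 - pairs 1 0 = A 0 * Y.
  apply/eqP; rewrite -subr_eq0; apply/eqP.
  apply: (@lazy_walk_uniq _ (fun d => pairs s d - pairs 1 d - A d * Y)) => d.
  by rewrite {1}DE {1}AE; ring.
have {}E : r * pairs s 0 = r * pairs 1 0 + Y.
  rewrite -{1}[pairs s 0](subrK (pairs 1 0)) mulrDr addrC E A0.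
  by rewrite mulVKr ?r_unit.
have T := pairs_all_gf R.
transitivity ((1 - 2 * z) * (r * pairs s 0 - Y - c)); first by rewrite /Y; ring.
rewrite E; transitivity (r * ((1 - 2 * z) * pairs 1 0) - c * (1 - 2 * z)); first ring.
by rewrite T; ring.
Qed.

End LazyWalk.

(** * From partitions to pairs of paths *)

Lemma partition_gf (R : comNzRingType) (s : R) (z := fpsX R) :
  fps_sum (fun la : intpart => s ^+ ds la *: z ^+ sp la) = 1 + z ^+ 2 * pairs s 0.
Proof.
pose empty : intpart := @IntPart [::] isT.
(* All partitions of semiperimeter [n]: none exists for [n = 1], and the two forced end steps
   account for the shift by 2. *)
pose list n := match n with
  | 0 => [:: empty] | 1 => [::] | m.+2 => [seq path_part r | r <- words m] end.
have sum_list n : (fps_sum (fun la : intpart => s ^+ ds la *: z ^+ sp la)) n =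
    \sum_(la <- list n) s ^+ ds la * (n == sp la)%:R.
  rewrite /= (@fsbigE _ _ _ _ _ (list n)) //.
  - by under eq_bigl do rewrite in_setT; apply: eq_bigr => la _; rewrite fcoefXn.
  - by case: n => [|[|n]] //=; rewrite map_inj_uniq ?words_uniq //;
       exact: path_part_inj.
  move=> la _; case: (eqVneq (parts la) [::]) => [la0|/path_part_surj[r ->]] notin.
    have -> : la = empty by exact: val_inj.
    rewrite fcoefXn; case: n notin => [|n _]; last by rewrite mulr0.
    by rewrite inE -val_eqE /= la0.
  rewrite fcoefXn sp_path_part; case: eqP => [nE|]; last by rewrite mulr0.
  by move: notin; rewrite nE /= map_f // mem_words.
apply/fpsP => n; rewrite sum_list fcoefD fcoef1 fcoefX2M.
case: n => [|[|n]]; rewrite ?big_seq1 ?big_nil ?mulr1 ?addr0 //.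
rewrite add0r big_map words_diagonal_sum; apply: eq_bigr => b _.
rewrite big_seq [RHS]big_seq; apply: eq_bigr => v; rewrite mem_words => /eqP vb.
rewrite big_seq [RHS]big_seq; apply: eq_bigr => w; rewrite mem_words => /eqP wb.
rewrite /weight add0r eqz_nat; case: eqP => // vw.
rewrite ds_path_part // sp_path_part catrevE size_cat size_rev size_map vb wb.
by rewrite subnK ?leq_ord // eqxx mulr1.
Qed.

Theorem theorem4p5 :
  let s : {poly rat} := 'X in
  let z : fps {poly rat} := fpsX {poly rat} in
  fps_sum (fun la : intpart => s ^+ ds la *: z ^+ sp la) =
  1 + z ^+ 2 * (sqrt_fps (1 - 4 * z ^+ 2) - (1 - s)%:A * (1 - 2 * z))
      / ((1 - 2 * z) * (2 * (1 - s)%:A * z ^+ 2 + sqrt_fps (1 - 4 * z ^+ 2))).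
Proof.
move=> s z; rewrite partition_gf -(pairs_gf unit2_polyrat).
set den := (1 - 2 * z) * _; congr (1 + _).
rewrite mulrCA [den * _]mulrC mulrK //; exact: denominator_unit.
Qed.
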